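(* Let $0<q<\infty$ and $1<p<\infty$. Let $a=\{a(m)\}_{m\in\mathbb N}$, $b=\{b(m)\}_{m\in\mathbb N}$ and $u=\{u(m)\}_{m\in\mathbb N}$ be given sequences of non-negative real numbers with $b(1)>0$. Consider the inequalities $$\bigg(\sum_{m=1}^{\infty}\bigg(\sup_{m\le i<\infty}u(i)\sum_{k=1}^{i}x(k)\bigg)^q a(m)\bigg)^{\frac1q}\le C\bigg(\sum_{m=1}^\infty x(m)^p b(m)\bigg)^{\frac1p}\qquad( * )$$ and $$\bigg(\sum_{m=1}^\infty\bigg(\sup_{m\le i<\infty}u(i)\sum_{k=1}^i\sum_{j=k}^\infty y(j)\bigg)^q a(m)\bigg)^{\frac1q}\le\mathcal D\bigg(\sum_{m=1}^\infty y(m)^p B(m+1)^{p-1}B(m)\,b(m+1)^{1-p}\bigg)^{\frac1p}.\qquad( ** )$$ Then $( * )$ holds, with some finite constant $C$ independent of $x$, for all non-negative, non-increasing sequences $x=\{x(m)\}_{m\in\mathbb N}$ if and only if $C_0<\infty$ and $( ** )$ holds, with some finite constant $\mathcal D$ independent of $y$, for all non-negative sequences $y=\{y(m)\}_{m\in\mathbb N}$. Moreover, if $C$ and $\mathcal D$ denote the best constants in $( * )$ and $( ** )$, respectively, then $C\approx\mathcal D+C_0$, where the multiplicative constants in the equivalence depend only on $p$ and $q$.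
   Context: $\mathbb N=\{1,2,3,\dots\}$. All given sequences have finite non-negative real entries; sums and suprema are taken in $[0,\infty]$. Notation: $B(m)=\sum_{k=1}^m b(k)$ for $m\in\mathbb N$, $B(\infty)=\lim_{m\to\infty}B(m)\in(0,\infty]$, and $$C_0:=\bigg(\sum_{m=1}^\infty\Big(\sup_{m\le i<\infty}u(i)\,i\Big)^q a(m)\bigg)^{\frac1q}B(\infty)^{-\frac1p},$$ where by convention $C_0=0$ when $B(\infty)=\infty$. Conventions: $0\cdot\infty=0$, $0/0=0$, $\infty/\infty=0$, $1/0=\infty$, $1/\infty=0$ (so $b(m+1)^{1-p}=\infty$ if $b(m+1)=0$); $\infty^\alpha=\infty$ for $\alpha>0$ and $\infty^\alpha=0$ for $\alpha<0$. The best constant in an inequality is the infimum of all finite constants for which it holds for all admissible sequences (non-negative non-increasing $x$ for $( * )$, non-negative $y$ for $( ** )$), and it equals $\infty$ if there is no such constant. For $X,Y\in[0,\infty]$, $X\approx Y$ means $c^{-1}Y\le X\le cY$ for some positive finite constant $c$ (here depending only on $p$ and $q$). *)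

(* Defs.v *)
From mathcomp Require Import all_boot all_order all_algebra.
From mathcomp Require Import all_classical all_reals all_analysis.

Set Implicit Arguments.
Unset Strict Implicit.
Unset Printing Implicit Defensive.

Import Order.TTheory GRing.Theory Num.Theory.
Import numFieldNormedType.Exports.

Local Open Scope ring_scope.
Local Open Scope ereal_scope.

(* Sequences indexed by {1, 2, 3, ...} are functions on nat whose value at
   index 0 is never used. *)

Definition nonneg_seq (R : realType) (x : nat -> R) : Prop :=
  forall m : nat, (1 <= m)%N -> (0 <= x m)%R.

Definition nonincreasing_from1 (R : realType) (x : nat -> R) : Prop :=
  forall m n : nat, (1 <= m)%N -> (m <= n)%N -> (x n <= x m)%R.

(* Power of x in [0, +oo] with a real exponent.  The library's poweR has
   0 `^ r = 0 and +oo `^ r = +oo for r < 0; here 0 is sent to +oo and +oo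
   to 0 in that case (inve sends 0 to +oo and +oo to 0). *)
Definition epow (R : realType) (x : \bar R) (r : R) : \bar R :=
  if (r < 0)%R then (x `^ (- r))^-1 else x `^ r.

Definition Bsum (R : realType) (b : nat -> R) (m : nat) : \bar R :=
  \sum_(1 <= k < m.+1) (b k)%:E.

Definition Binf (R : realType) (b : nat -> R) : \bar R :=
  \sum_(1 <= k <oo) (b k)%:E.

(* The quantity (sum_m (sup_{m <= i} u(i) s(i))^q a(m))^(1/q), with the
   product 0 * +oo = 0. *)
Definition sup_norm (R : realType) (q : R) (a u : nat -> R)
    (s : nat -> \bar R) : \bar R :=
  epow (\sum_(1 <= m <oo)
          epow (esups (fun i : nat => (u i)%:E * s i) m) q * (a m)%:E)
       (q^-1)%R.

Definition lhs_x (R : realType) (q : R) (a u x : nat -> R) : \bar R :=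
  sup_norm q a u (fun i : nat => \sum_(1 <= k < i.+1) (x k)%:E).

Definition rhs_x (R : realType) (p : R) (b x : nat -> R) : \bar R :=
  epow (\sum_(1 <= m <oo) epow (x m)%:E p * (b m)%:E) (p^-1)%R.

Definition lhs_y (R : realType) (q : R) (a u y : nat -> R) : \bar R :=
  sup_norm q a u
    (fun i : nat => \sum_(1 <= k < i.+1) \sum_(k <= j <oo) (y j)%:E).

Definition rhs_y (R : realType) (p : R) (b y : nat -> R) : \bar R :=
  epow (\sum_(1 <= m <oo)
          epow (y m)%:E p * epow (Bsum b m.+1) (p - 1)%R * Bsum b m
          * epow (b m.+1)%:E (1 - p)%R)
       (p^-1)%R.

Definition holds_x (R : realType) (p q : R) (a b u : nat -> R) (C : R) : Prop :=
  forall x : nat -> R, nonneg_seq x -> nonincreasing_from1 x ->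
    lhs_x q a u x <= C%:E * rhs_x p b x.

Definition holds_y (R : realType) (p q : R) (a b u : nat -> R) (D : R) : Prop :=
  forall y : nat -> R, nonneg_seq y ->
    lhs_y q a u y <= D%:E * rhs_y p b y.

(* The infimum of the empty set is +oo. *)
Definition best_x (R : realType) (p q : R) (a b u : nat -> R) : \bar R :=
  ereal_inf [set C%:E | C in [set C : R | (0 <= C)%R /\ holds_x p q a b u C]].

Definition best_y (R : realType) (p q : R) (a b u : nat -> R) : \bar R :=
  ereal_inf [set D%:E | D in [set D : R | (0 <= D)%R /\ holds_y p q a b u D]].

(* When Binf b = +oo the second factor is 0, hence C0 = 0. *)
Definition C0 (R : realType) (p q : R) (a b u : nat -> R) : \bar R :=
  sup_norm q a u (fun i : nat => (i%:R)%:E) * epow (Binf b) (- p^-1)%R.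

(* Main.v *)
Require Import Defs.
From mathcomp Require Import all_boot all_order all_algebra.
From mathcomp Require Import all_classical all_reals all_analysis.
From mathcomp Require Import ring lra.
Import Order.TTheory GRing.Theory Num.Theory.
Import numFieldNormedType.Exports.

(* Testing ( * ) on x = 1 gives C_0 <= C, and testing it on the tails
   x(k) = sum_{j >= k} y(j) gives ( ** ), because Copson's inequality
     sum_m b(m) x(m)^p <= K sum_m y(m)^p v(m)
   holds for the weight v(m) = B(m+1)^(p-1) B(m) b(m+1)^(1-p) of ( ** ).

   Conversely, let sigma(m) be the b-weighted mean of x(1), ..., x(m), let
   theta(m) = b(m+1) / B(m+1), and take y = theta sigma.  Since x is
   non-increasing, x <= sigma; since
     sigma(m+1) >= (1 - theta(m)) sigma(m) = sigma(m) - y(m),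
   telescoping gives x(k) <= inf sigma + sum_{j >= k} y(j).  Hardy's inequality
   bounds both sum_m y(m)^p v(m) = sum_m B(m) theta(m) sigma(m)^p and
   B(m) sigma(m)^p by K sum_m b(m) x(m)^p; the second bound makes the constant
   inf sigma at most (K sum_m b(m) x(m)^p / B(oo))^(1/p), which C_0 takes care
   of.

   With theta, the weight of ( ** ) reads v(m) = B(m) theta(m)^(1-p). *)

Set Implicit Arguments.
Unset Strict Implicit.
Unset Printing Implicit Defensive.

Local Open Scope ring_scope.

(** * Elementary inequalities for real powers *)

Section PowerInequalities.
Variables (R : realType).
Implicit Types (p r s t e : R).

(** Convexity of the power function, obtained from Young's inequality for t and s^(p-1) with
    exponents p and p/(p-1). *)
Lemma powR_sub_le_tangent p s t : 1 < p -> 0 <= s -> 0 <= t ->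
  s `^ p - t `^ p <= p * s `^ (p - 1) * (s - t).
Proof.
move=> p1 s0 t0.
have p0 : 0 < p by lra.
have q0 : 0 < p / (p - 1) by rewrite divr_gt0 //; lra.
have pq : p^-1 + (p / (p - 1))^-1 = 1.
  by field; apply/andP; split; lra.
have := conjugate_powR t0 (powR_ge0 s (p - 1)) p0 q0 pq.
rewrite -powRrM (_ : (p - 1) * (p / (p - 1)) = p); last by field; lra.
rewrite -(ler_pM2l p0) mulrDr.
rewrite (_ : p * (t `^ p / p) = t `^ p); last by field; lra.
rewrite (_ : p * (s `^ p / (p / (p - 1))) = (p - 1) * s `^ p); last first.
  by field; apply/andP; split; lra.
have := mulr_powRB1 s0 p0 => <-; lra.
Qed.

(** A weighted Young inequality with crude constants: for t <= e s the first term suffices;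
    otherwise s <= t/e and the second does. *)
Lemma powR_mul_absorb p e s t : 1 < p -> 0 < e -> 0 <= s -> 0 <= t ->
  s `^ (p - 1) * t <= e * s `^ p + e `^ (1 - p) * t `^ p.
Proof.
move=> p1 e0 s0 t0; have p0 : 0 < p by lra.
have [tes|est] := leP t (e * s).
  rewrite -[leLHS]addr0 lerD ?mulr_ge0 ?powR_ge0 //.
  rewrite -(mulr_powRB1 s0 p0) mulrA mulrC ler_wpM2r ?powR_ge0 //.
have ts : s <= t / e by rewrite ler_pdivlMr // mulrC ltW.
rewrite -[leLHS]add0r lerD ?mulr_ge0 ?powR_ge0 ?(ltW e0)//.
rewrite -(mulr_powRB1 t0 p0) mulrC mulrCA ler_wpM2l //.
rewrite (_ : 1 - p = -1 * (p - 1)); last by ring.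
rewrite powRrM powR_inv1 ?(ltW e0)// mulrC -powRM ?invr_ge0 ?(ltW e0)//.
by rewrite ge0_ler_powR ?nnegrE //; [lra|rewrite divr_ge0 // ltW].
Qed.

Lemma powR_add_le p s t : 0 <= p -> 0 <= s -> 0 <= t ->
  (s + t) `^ p <= 2 `^ p * (s `^ p + t `^ p).
Proof.
move=> p0; wlog st : s t / s <= t => [H s0 t0|s0 t0].
  have [st|ts] := leP s t; first exact: H.
  by rewrite addrC [X in _ * X]addrC; apply: H => //; exact: ltW.
apply: (@le_trans _ _ ((2 * t) `^ p)).
  by rewrite ge0_ler_powR ?nnegrE ?addr_ge0 ?mulr_ge0 //; lra.
by rewrite powRM // ler_wpM2l ?powR_ge0 // lerDr powR_ge0.
Qed.

(** Taken at s = p - 1 and r = 1 - theta, this trades the factor 1 - (1 - theta)^(p-1), which the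
    summation produces, for theta. For s >= 1 it follows from r^s <= r, for s < 1 from the tangent
    inequality with exponent 1/s at the points 1 and r^s. *)
Lemma onem_le_onem_powR s r : 0 < s -> 0 <= r <= 1 ->
  1 - r <= (1 + s^-1) * (1 - r `^ s).
Proof.
move=> s0 /andP[r0 r1].
have rs1 : r `^ s <= 1.
  by have := ge0_ler_powR (ltW s0) r0 ler01 r1; rewrite powR1.
have si0 : 0 < s^-1 by rewrite invr_gt0.
have [s1|s1] := leP 1 s.
  have rr : r `^ s <= r.
    have [->|rn0] := eqVneq r 0; first by rewrite powR0 // gt_eqF.
    by rewrite ge1r_powR // lt_def rn0 r0.
  nra.
have p1 : 1 < s^-1 by rewrite invf_gt1.
have := powR_sub_le_tangent p1 ler01 (powR_ge0 r s).
rewrite -powRrM mulfV ?gt_eqF // powRr1 // !powR1 mulr1; nra.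
Qed.

End PowerInequalities.

(** * Partial sums, weighted means and the two summation inequalities behind Hardy's *)

Section DiscreteHardy.
Variable R : realType.
Implicit Types (p : R) (b x y X : nat -> R).

Definition psum b (n : nat) : R := \sum_(1 <= k < n.+1) b k.

Lemma psumS b n : psum b n.+1 = psum b n + b n.+1.
Proof. by rewrite /psum big_nat_recr. Qed.

Lemma psum0 b : psum b 0 = 0.
Proof. by rewrite /psum big_geq. Qed.

Lemma psum_ge0 b n : nonneg_seq b -> 0 <= psum b n.
Proof. by move=> b0; rewrite /psum big_nat sumr_ge0 // => i /andP[/b0]. Qed.

Lemma le_psum b c n : (forall m, (1 <= m)%N -> b m <= c m) ->
  psum b n <= psum c n.
Proof. by move=> bc; rewrite /psum !big_nat ler_sum // => i /andP[/bc]. Qed.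

Lemma psum_nondecreasing b m n : nonneg_seq b -> (m <= n)%N ->
  psum b m <= psum b n.
Proof.
move=> b0; elim: n => [|n IH]; first by rewrite leqn0 => /eqP ->.
rewrite leq_eqVlt => /predU1P[->//|]; rewrite ltnS => /IH /le_trans; apply.
by rewrite psumS lerDl b0.
Qed.

Lemma psum_gt0 b n : nonneg_seq b -> 0 < b 1%N -> 0 < psum b n.+1.
Proof.
move=> b0 b1; rewrite (lt_le_trans b1) //.
by rewrite (le_trans _ (psum_nondecreasing b0 (ltn0Sn n))) // psumS psum0 add0r.
Qed.

(* 0 / 0 = 0 at n = 0, so psum_wmean and psum_wmeanS hold from index 0 on. *)
Definition wmean b x (n : nat) : R := psum (fun k => b k * x k) n / psum b n.

(* The theta of the introduction. *)
Definition relinc b (n : nat) : R := b n.+1 / psum b n.+1.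

Lemma nonneg_seqM b x : nonneg_seq b -> nonneg_seq x ->
  nonneg_seq (fun k => b k * x k).
Proof. by move=> b0 x0 m m1; rewrite mulr_ge0 ?b0 ?x0. Qed.

Lemma nonneg_seq_powR p x : nonneg_seq (fun k => x k `^ p).
Proof. by move=> m _; exact: powR_ge0. Qed.

Section FixedWeight.
Variable b : nat -> R.
Hypotheses (b0 : nonneg_seq b) (b1 : 0 < b 1%N).

Lemma wmean_ge0 x n : nonneg_seq x -> 0 <= wmean b x n.
Proof. by move=> x0; rewrite divr_ge0 ?psum_ge0 //; exact: nonneg_seqM. Qed.

Lemma psum_wmean x n :
  psum b n * wmean b x n = psum (fun k => b k * x k) n.
Proof.
case: n => [|n]; first by rewrite !psum0 mul0r.
by rewrite mulrC divfK // gt_eqF // psum_gt0.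
Qed.

Lemma psum_wmeanS x n :
  psum b n.+1 * wmean b x n.+1 = psum b n * wmean b x n + b n.+1 * x n.+1.
Proof. by rewrite !psum_wmean psumS. Qed.

Lemma relinc_ge0 n : 0 <= relinc b n.
Proof. by rewrite divr_ge0 ?psum_ge0 // b0. Qed.

Lemma relinc_le1 n : relinc b n <= 1.
Proof. by rewrite ler_pdivrMr ?psum_gt0 // mul1r psumS lerDr psum_ge0. Qed.

Lemma psum_relincE n : psum b n.+1 * relinc b n = b n.+1.
Proof. by rewrite mulrC divfK // gt_eqF // psum_gt0. Qed.

Lemma psum_onem_relinc n : psum b n.+1 * (1 - relinc b n) = psum b n.
Proof. by rewrite mulrBr psum_relincE psumS; ring. Qed.

(* b x is the increment of B sigma, so the tangent inequality between sigma(n)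
   and sigma(n + 1) makes each induction step telescope. *)
Lemma elliott_ineq p x n : 1 < p -> nonneg_seq x ->
  (p - 1) * psum (fun k => b k * wmean b x k `^ p) n
    + psum b n * wmean b x n `^ p
  <= p * psum (fun k => b k * (wmean b x k `^ (p - 1) * x k)) n.
Proof.
move=> p1 x0; elim: n => [|n IH]; first by rewrite !psum0; lra.
rewrite !(psumS (fun k => _)) -/(psum b).
set s := wmean b x n.+1; set t := wmean b x n.
have s0 : 0 <= s by exact: wmean_ge0.
have t0 : 0 <= t by exact: wmean_ge0.
have := powR_sub_le_tangent p1 s0 t0.
move=> /(ler_wpM2l (psum_ge0 n b0)); have := psum_wmeanS x n.
rewrite -/s -/t psumS; rewrite -/t in IH.
have := mulr_powRB1 s0 (lt_trans ltr01 p1).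
move: IH (s `^ (p - 1)) => IH w <-.
set P := psum b n in IH *; set u := b n.+1; set z := x n.+1 => E.
rewrite (_ : p * (_ + u * (w * z)) =
  p * psum (fun k => b k * (wmean b x k `^ (p - 1) * x k)) n
    + p * w * (u * z)); last by ring.
have -> : u * z = (P + u) * s - P * t by rewrite E; ring.
lra.
Qed.

(* Tangent inequality between sigma(k + 1) and (1 - theta(k)) sigma(k), using
   B(k+1) (1 - theta(k))^p = B(k) (1 - theta(k))^(p-1). *)
Lemma psum_relinc_wmean_le p x n : 1 < p -> nonneg_seq x ->
  psum (fun k => psum b k * wmean b x k `^ p
                 * (1 - (1 - relinc b k) `^ (p - 1))) n
    + psum b n.+1 * wmean b x n.+1 `^ p
  <= p * psum (fun k => b k * (wmean b x k `^ (p - 1) * x k)) n.+1.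
Proof.
move=> p1 x0; elim: n => [|n IH].
  (* The base case is [elliott_ineq] at 1 with its first sum dropped. *)
  have := elliott_ineq 1 p1 x0; rewrite !psumS !psum0 !add0r.
  rewrite -[X in X <= _ -> _]addrC => /(le_trans _); apply.
  by rewrite lerDl mulr_ge0 ?mulr_ge0 ?powR_ge0 ?b0 //; lra.
rewrite (psumS (fun k => _ * _ * _)) [psum (fun k => b k * _) _]psumS.
set s := wmean b x n.+2; set t := wmean b x n.+1.
have s0 : 0 <= s by exact: wmean_ge0.
have t0 : 0 <= t by exact: wmean_ge0.
have r0 : 0 <= 1 - relinc b n.+1 by rewrite subr_ge0 relinc_le1.
have := powR_sub_le_tangent p1 s0 (mulr_ge0 r0 t0).
move=> /(ler_wpM2l (ltW (psum_gt0 n.+1 b0 b1))).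
have := psum_wmeanS x n.+1; rewrite -/s -/t.
have := psum_onem_relinc n.+1.
have := mulr_powRB1 r0 (lt_trans ltr01 p1).
rewrite (powRM _ r0 t0); rewrite -/t in IH.
move: IH.
move: (relinc b n.+1) r0 (s `^ (p - 1)) (s `^ p) (t `^ p).
move=> r r0 w sp tp IH <- E1 E2 T.
move: ((1 - r) `^ (p - 1)) T => v T.
move: IH E1 E2 T.
rewrite !mulrBr !mulrDr.
set P' := psum b n.+2; set P := psum b n.+1; set u := b n.+2.
set z := x n.+2 => IH E1 E2 T.
(* B(k+1) (sigma(k+1) - (1 - theta(k)) sigma(k)) = b(k+1) x(k+1), so the tangent inequality has the
   new summand as its right-hand side. *)
have E3 : P' * (p * w * s) - P' * (p * w * ((1 - r) * t))
   = p * (u * (w * z)).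
  have -> : P' * (p * w * s) - P' * (p * w * ((1 - r) * t))
     = p * w * (P' * s - (P' * 1 - P' * r) * t) by ring.
  by rewrite E1 E2; ring.
have E4 : P' * ((1 - r) * v * tp) = P * tp * v.
  by rewrite -E1; ring.
rewrite E3 E4 in T; lra.
Qed.

End FixedWeight.
End DiscreteHardy.

(** * Hardy's and Copson's inequalities for finite sums *)

Section HardyCopson.
Variable R : realType.
Implicit Types (p : R) (b c x X : nat -> R).

Lemma psumD b c n : psum (fun k => b k + c k) n = psum b n + psum c n.
Proof. exact: big_split. Qed.

Lemma psumZ (a : R) b n : psum (fun k => a * b k) n = a * psum b n.
Proof. by rewrite /psum mulr_sumr. Qed.

Lemma psum_shift b n : psum b n.+1 = b 1%N + psum (fun k => b k.+1) n.
Proof.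
elim: n => [|n IH]; first by rewrite psumS !psum0 addrC.
by rewrite psumS IH (psumS (fun k => b k.+1)) addrA.
Qed.

Lemma psum_abel b X n :
  psum (fun k => b k * X k) n
  = psum (fun k => psum b k * (X k - X k.+1)) n + psum b n * X n.+1.
Proof.
elim: n => [|n IH]; first by rewrite !psum0 mul0r addr0.
by rewrite !psumS IH; ring.
Qed.

(** Both bounds pass through the mixed sum of b sigma^(p-1) x, which [Mle] controls by the sum of b
    x^p. The first then comes from [psum_relinc_wmean_le] and [onem_le_onem_powR], the second from
    [elliott_ineq] without its first sum. *)
Lemma hardy_ineq p : 1 < p -> exists2 K : R, 0 < K &
  forall b x n, nonneg_seq b -> 0 < b 1%N -> nonneg_seq x ->
    psum (fun k => psum b k * wmean b x k `^ p * relinc b k) n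
      <= K * psum (fun k => b k * x k `^ p) n.+1 /\
    psum b n * wmean b x n `^ p <= K * psum (fun k => b k * x k `^ p) n.
Proof.
(* This e gives p e = (p - 1)/2, half the coefficient of the sum of b sigma^p in [elliott_ineq],
   which can therefore absorb it. *)
move=> p1; pose e := (p - 1) / (2 * p); pose c := e `^ (1 - p).
have e0 : 0 < e by rewrite divr_gt0 //; lra.
have c0 : 0 < c by exact: powR_gt0.
have pi0 : 0 < (p - 1)^-1 by rewrite invr_gt0; lra.
exists ((1 + (p - 1)^-1) * (p * (2 * c))).
  by rewrite !mulr_gt0 //; lra.
move=> b x n b0 b1 x0.
have A0 m : 0 <= psum (fun k => b k * wmean b x k `^ p) m.
  by rewrite psum_ge0 //; apply: nonneg_seqM => //; exact: nonneg_seq_powR.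
have Z0 m : 0 <= psum (fun k => b k * x k `^ p) m.
  by rewrite psum_ge0 //; apply: nonneg_seqM => //; exact: nonneg_seq_powR.
have Bw0 m : 0 <= psum b m * wmean b x m `^ p.
  by rewrite mulr_ge0 ?psum_ge0 ?powR_ge0.
have Mle m : psum (fun k => b k * (wmean b x k `^ (p - 1) * x k)) m
             <= 2 * c * psum (fun k => b k * x k `^ p) m.
  have := elliott_ineq b0 b1 m p1 x0.
  have : psum (fun k => b k * (wmean b x k `^ (p - 1) * x k)) m <=
         psum (fun k => e * (b k * wmean b x k `^ p)
                        + c * (b k * x k `^ p)) m.
    apply: le_psum => k k1.
    have := powR_mul_absorb p1 e0 (wmean_ge0 b0 k x0) (x0 _ k1).
    by move=> /(ler_wpM2l (b0 _ k1)) /le_trans; apply; rewrite /c; lra.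
  rewrite psumD !psumZ; have := A0 m; have := Z0 m; have := Bw0 m.
  set Z := psum (fun k => b k * x k `^ p) m.
  set A := psum (fun k => b k * wmean b x k `^ p) m.
  set M := psum (fun k => b k * (wmean b x k `^ (p - 1) * x k)) m.
  move=> B A' Z' H1 H2.
  have eE : p * e = (p - 1) / 2 by rewrite /e; field; lra.
  have H3 : p * M <= p * e * A + p * c * Z.
    by move: H1 => /(ler_wpM2l (ltW (lt_trans ltr01 p1))); lra.
  rewrite eE in H3.
  have H5 : p * M <= p * (2 * c * Z) by lra.
  by move: H5; rewrite ler_pM2l //; lra.
have KE m : 0 <= p * (2 * c) * psum (fun k => b k * x k `^ p) m.
  by rewrite !mulr_ge0 //; lra.
split.
  have := psum_relinc_wmean_le b0 b1 n p1 x0.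
  have := Mle n.+1; have := Bw0 n.+1.
  have : psum (fun k => psum b k * wmean b x k `^ p * relinc b k) n <=
    psum (fun k => (1 + (p - 1)^-1) * (psum b k * wmean b x k `^ p
                 * (1 - (1 - relinc b k) `^ (p - 1)))) n.
    apply: le_psum => k k1; rewrite [leRHS]mulrCA ler_wpM2l //.
    have := @onem_le_onem_powR R (p - 1) (1 - relinc b k).
    rewrite subKr; apply; first lra.
    have := relinc_ge0 b0 k; have := relinc_le1 b0 b1 k; lra.
  rewrite psumZ => H1 H2 H3 H4; apply: (le_trans H1).
  rewrite -[leRHS]mulrA ler_wpM2l //; first lra.
  by move: H3 => /(ler_wpM2l (ltW (lt_trans ltr01 p1))); lra.
have := elliott_ineq b0 b1 n p1 x0; have := A0 n; have := Mle n.
move=> /(ler_wpM2l (ltW (lt_trans ltr01 p1))) H1 H2 H3.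
have H4 : psum b n * wmean b x n `^ p <=
    p * (2 * c * psum (fun k => b k * x k `^ p) n) by nra.
apply: (le_trans H4); have := KE n; nra.
Qed.

(** Summation by parts turns the left-hand side into the terms B(k) (X(k)^p - X(k+1)^p), which the
    tangent inequality bounds through the differences of X. Where b(k+1) = 0, the real power
    theta(k)^(1-p) is 0 instead of infinite; the last hypothesis makes up for that. *)
Lemma copson_ineq p : 1 < p -> exists2 K : R, 0 < K &
  forall b X n, nonneg_seq b -> 0 < b 1%N -> nonneg_seq X ->
    (forall k, (1 <= k)%N -> X k.+1 <= X k) -> X n.+1 = 0 ->
    (forall k, (1 <= k)%N -> b k.+1 = 0 -> X k = X k.+1) ->
    psum (fun k => b k * X k `^ p) n
      <= K * psum (fun k => (X k - X k.+1) `^ p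
                            * (psum b k * relinc b k `^ (1 - p))) n.
Proof.
(* The choice p e 2^p = 1/2 lets the left-hand side absorb the sum of the
   b(k+1) X(k+1)^p produced by [step]. *)
move=> p1; pose e := (2 * p * 2 `^ p)^-1; pose c := e `^ (1 - p).
have p0 : 0 < p by lra.
have tp0 : 0 < 2 `^ p :> R by exact: powR_gt0.
have e0 : 0 < e by rewrite invr_gt0 !mulr_gt0.
have c0 : 0 < c by exact: powR_gt0.
exists (1 + 2 * p * c); first by rewrite addr_gt0 // !mulr_gt0.
move=> b X n b0 b1 X0 Xdec Xn Xb.
set A := psum _ n; set V := psum _ n.
pose y k := X k - X k.+1.
pose v k := psum b k * relinc b k `^ (1 - p).
have y0 k : (1 <= k)%N -> 0 <= y k by move=> k1; rewrite subr_ge0 Xdec.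
have step k : (1 <= k)%N ->
    psum b k * (X k `^ p - X k.+1 `^ p) <=
    p * e * 2 `^ p * (b k.+1 * X k.+1 `^ p)
      + (p * e * 2 `^ p + p * c) * (y k `^ p * v k).
  move=> k1.
  have B0 := psum_ge0 k b0.
  have [bk|bk] := eqVneq (b k.+1) 0.
    rewrite -(Xb _ k1 bk) subrr mulr0 addr_ge0 //.
      by rewrite !mulr_ge0 ?powR_ge0 ?b0 // ltW.
    rewrite mulr_ge0 ?addr_ge0 ?mulr_ge0 ?powR_ge0 ?(ltW e0) ?(ltW c0) //.
    - by rewrite ltW.
    - by rewrite ltW.
  have th0 : 0 < relinc b k.
    by rewrite divr_gt0 ?psum_gt0 // lt_def bk b0.
  have th1 := relinc_le1 b0 b1 k.
  have T := powR_sub_le_tangent p1 (X0 _ k1) (X0 k.+1 isT).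
  (* With the parameter e theta(k), the first term carries B(k) theta(k) <= b(k+1) and the second
     the Copson weight, since (e theta)^(1-p) = c theta^(1-p). *)
  have := powR_mul_absorb p1 (mulr_gt0 e0 th0) (X0 _ k1) (y0 _ k1).
  rewrite (powRM _ (ltW e0) (ltW th0)) -/c => Ab.
  (* The factor b(k+1) calls for X(k+1)^p in place of X(k)^p; the change costs 2^p and a term theta
     y^p, covered by theta <= theta^(1-p). *)
  have Xk : X k = X k.+1 + y k by rewrite /y addrC subrK.
  have D := powR_add_le (ltW p0) (X0 k.+1 isT) (y0 _ k1).
  rewrite -Xk in D.
  have thp : relinc b k <= relinc b k `^ (1 - p).
    by rewrite ger1_powR // ?th0 //; lra.
  have Bth : psum b k * relinc b k <= b k.+1.
    by rewrite -(psum_relincE b0 b1 k) ler_wpM2r ?(ltW th0) // psumS lerDl b0.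
  rewrite /v; move: (relinc b k) th0 th1 T Ab D thp Bth B0.
  move: (psum b k) => B th th0 th1; rewrite -/(y k).
  have := powR_ge0 (X k.+1) p; have := powR_ge0 (y k) p.
  move: (y k) (y k `^ p) (X k `^ p) (X k.+1 `^ p) (X k `^ (p - 1)).
  move=> z yp Xp Xp' Xq yp0 Xp0.
  move: (th `^ (1 - p)) (2 `^ p : R) tp0 => w d d0 T Ab D thw Bth B0.
  have H1 : B * (Xp - Xp') <= p * (e * (B * th * Xp) + c * (B * w * yp)).
    apply: (@le_trans _ _ (p * (B * (Xq * z)))); first nra.
    by rewrite ler_pM2l //; move: Ab => /(ler_wpM2l B0); lra.
  have H2 : B * th * Xp <= d * (b k.+1 * Xp' + B * w * yp).
    apply: (@le_trans _ _ (B * th * (d * (Xp' + yp)))).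
      by rewrite ler_wpM2l // mulr_ge0 // ltW.
    rewrite mulrCA ler_pM2l // mulrDr lerD // ler_wpM2r //.
    by rewrite ler_wpM2l.
  apply: (le_trans H1); move: H2 => /(ler_wpM2l (ltW (mulr_gt0 p0 e0))); lra.
have AE : A <= p * e * 2 `^ p * psum (fun k => b k.+1 * X k.+1 `^ p) n
               + (p * e * 2 `^ p + p * c) * V.
  rewrite /A psum_abel Xn powR0 ?mulr0 ?addr0 ?gt_eqF //.
  rewrite -psumZ -[X in _ <= _ + X]psumZ -psumD; exact: le_psum.
(* As X(n+1) = 0, shifting the index only loses the first term. Hence A <= A/2 + (1/2 + p c) V,
   which explains the constant 1 + 2 p c. *)
have shA : psum (fun k => b k.+1 * X k.+1 `^ p) n <= A.
  have := psum_shift (fun k => b k * X k `^ p) n.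
  rewrite psumS Xn powR0 ?mulr0 ?addr0 ?gt_eqF // -/A => ->.
  by rewrite lerDr mulr_ge0 ?powR_ge0 ?b0.
have eE : p * e * 2 `^ p = 2^-1.
  by rewrite /e; field; rewrite !gt_eqF.
rewrite eE in AE; lra.
Qed.

End HardyCopson.

Local Open Scope ereal_scope.

(** * Series and powers in [0, +oo] *)

Section NonnegativeSeries.
Variable R : realType.
Implicit Types (f g : nat -> \bar R) (r : R).

Lemma lee_sum_from1 f g n : (forall m, (1 <= m)%N -> f m <= g m) ->
  \sum_(1 <= m < n.+1) f m <= \sum_(1 <= m < n.+1) g m.
Proof. by move=> fg; rewrite !big_nat lee_sum // => m /andP[/fg]. Qed.

Lemma sume_from1_ge0 f n : (forall m, (1 <= m)%N -> 0 <= f m) ->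
  0 <= \sum_(1 <= m < n.+1) f m.
Proof. by move=> f0; rewrite big_nat sume_ge0 // => m /andP[/f0]. Qed.

Lemma sum_one_from1 n : \sum_(1 <= k < n.+1) (1%R : R)%:E = (n%:R)%:E.
Proof.
by rewrite sumEFin; congr EFin; rewrite big_const_nat subn1 /= iter_addr_0.
Qed.

Lemma nneseries_from1_le f (c : \bar R) : (forall m, (1 <= m)%N -> 0 <= f m) ->
  (forall n, \sum_(1 <= m < n.+1) f m <= c) -> \sum_(1 <= m <oo) f m <= c.
Proof.
move=> f0 fc; apply: lime_le.
  by apply: is_cvg_nneseries => n n1 _; exact: f0.
apply: nearW => -[|n]; last exact: fc.
by rewrite big_geq // (le_trans _ (fc 0%N)) // big_geq.
Qed.

Lemma nneseries_from1_ge f n : (forall m, (1 <= m)%N -> 0 <= f m) ->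
  \sum_(1 <= m < n.+1) f m <= \sum_(1 <= m <oo) f m.
Proof. by move=> f0; apply: nneseries_lim_ge => m m1 _; exact: f0. Qed.

Lemma le_nneseries_from1 f g : (forall m, (1 <= m)%N -> 0 <= f m <= g m) ->
  \sum_(1 <= m <oo) f m <= \sum_(1 <= m <oo) g m.
Proof.
move=> fg; apply: nneseries_from1_le => [m /fg/andP[]//|n].
apply: le_trans (nneseries_from1_ge n _) => [|m /fg/andP[f0]]; last first.
  exact: le_trans.
by apply: lee_sum_from1 => m /fg/andP[].
Qed.

Lemma nneseries_from1Zl_le (c : \bar R) f : 0 <= c ->
  (forall m, (1 <= m)%N -> 0 <= f m) ->
  \sum_(1 <= m <oo) (c * f m) <= c * \sum_(1 <= m <oo) f m.
Proof.
move=> c0 f0; apply: nneseries_from1_le => [m /f0 fm|n]; first exact: mule_ge0.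
rewrite big_nat -ge0_sume_distrr => [|m /andP[/f0]//].
by rewrite -big_nat lee_wpmul2l // nneseries_from1_ge.
Qed.

Lemma epow_ge0E (x : \bar R) r : (0 <= r)%R -> epow x r = x `^ r.
Proof. by move=> r0; rewrite /epow ltNge r0. Qed.

Lemma epow_ge0 (x : \bar R) r : 0 <= epow x r.
Proof. by rewrite /epow; case: ifP; rewrite ?inve_ge0 poweR_ge0. Qed.

Lemma le_poweR (x y : \bar R) r : (0 <= r)%R -> 0 <= x -> x <= y ->
  x `^ r <= y `^ r.
Proof.
by move=> r0 x0 xy; rewrite gt0_ler_poweR ?in_itv /= ?x0 ?(le_trans x0) ?leey.
Qed.

Lemma poweRD_le (x y : \bar R) r : (0 < r)%R -> 0 <= x -> 0 <= y ->
  (x + y) `^ r <= (x `^ r + y `^ r) * (2 `^ r)%:E.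
Proof.
move=> r0; have tp0 : (0 < 2 `^ r :> R)%R by exact: powR_gt0.
case: x y => [x| |] [y| |] //; rewrite ?lee_fin => x0 y0.
- by rewrite mulrC powR_add_le // ltW.
- by rewrite addey // !poweRyr ?gt_eqF // addey // gt0_mulye // lte_fin.
- by rewrite addye // !poweRyr ?gt_eqF // addye // gt0_mulye // lte_fin.
- by rewrite addye // !poweRyr ?gt_eqF // addye // gt0_mulye // lte_fin.
Qed.

Lemma poweRK (x : \bar R) r : r != 0%R -> 0 <= x -> (x `^ r) `^ r^-1 = x.
Proof. by move=> r0 x0; rewrite -poweRrM mulfV // poweRe1. Qed.

End NonnegativeSeries.

(** * The left-hand side functional: monotonicity, homogeneity, quasi-triangle inequality *)

Section SupNorm.
Variables (R : realType) (q : R) (a u : nat -> R).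
Hypotheses (q0 : (0 < q)%R) (a0 : nonneg_seq a) (u0 : nonneg_seq u).
Implicit Types s t : nat -> \bar R.

Let esup s m : \bar R := esups (fun i => (u i)%:E * s i) m.

Let le_esup s m (c : \bar R) :
  (forall i, (m <= i)%N -> (u i)%:E * s i <= c) -> esup s m <= c.
Proof. by move=> sc; apply: ge_ereal_sup => _ [i /= mi <-]; exact: sc. Qed.

Let esup_ge s m i : (m <= i)%N -> (u i)%:E * s i <= esup s m.
Proof. by move=> mi; apply: ereal_sup_ubound; exists i. Qed.

Let ueE i : (1 <= i)%N -> 0 <= (u i)%:E.
Proof. by move=> i1; rewrite lee_fin u0. Qed.

Let esup_ge0 s m : (1 <= m)%N -> (forall i, (1 <= i)%N -> 0 <= s i) ->
  0 <= esup s m.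
Proof.
move=> m1 s0; apply: le_trans (esup_ge s (leqnn m)).
by rewrite mule_ge0 ?ueE ?s0.
Qed.

Let term_ge0 s m : (1 <= m)%N -> 0 <= epow (esup s m) q * (a m)%:E.
Proof. by move=> m1; rewrite mule_ge0 ?epow_ge0 // lee_fin a0. Qed.

Lemma sup_norm_ge0 s : 0 <= sup_norm q a u s.
Proof. exact: epow_ge0. Qed.

Let sup_normE s : sup_norm q a u s =
  (\sum_(1 <= m <oo) epow (esup s m) q * (a m)%:E) `^ q^-1.
Proof. by rewrite /sup_norm epow_ge0E // invr_ge0 ltW. Qed.

Lemma le_sup_norm s t : (forall i, (1 <= i)%N -> 0 <= s i <= t i) ->
  sup_norm q a u s <= sup_norm q a u t.
Proof.
move=> st; rewrite !sup_normE le_poweR ?invr_ge0 ?(ltW q0) //.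
  by apply: nneseries_ge0 => m m1 _; exact: term_ge0.
apply: le_nneseries_from1 => m m1; rewrite term_ge0 //=.
rewrite lee_wpmul2r ?lee_fin ?a0 // !epow_ge0E ?(ltW q0) //.
rewrite le_poweR ?(ltW q0)//.
  by apply: esup_ge0 => // i /st/andP[].
apply: le_esup => i mi; have i1 := leq_trans m1 mi.
apply: le_trans (esup_ge t mi); rewrite lee_wpmul2l ?ueE //.
by have /andP[] := st _ i1.
Qed.

Lemma sup_normZ_le (c : \bar R) s : 0 <= c ->
  (forall i, (1 <= i)%N -> 0 <= s i) ->
  sup_norm q a u (fun i => c * s i) <= c * sup_norm q a u s.
Proof.
move=> c0 s0; rewrite !sup_normE.
have qi0 : (0 <= q^-1)%R by rewrite invr_ge0 ltW.
rewrite -[X in X * _](poweRK (lt0r_neq0 q0) c0).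
rewrite -poweRM ?poweR_ge0 //; last first.
  by apply: nneseries_ge0 => m m1 _; exact: term_ge0.
rewrite le_poweR //; first by apply: nneseries_ge0 => m m1 _; exact: term_ge0.
apply: (le_trans _ (nneseries_from1Zl_le (poweR_ge0 c q) _)); last first.
  by move=> m; exact: term_ge0.
apply: le_nneseries_from1 => m m1; rewrite term_ge0 //= muleA.
rewrite lee_wpmul2r ?lee_fin ?a0 // !epow_ge0E ?(ltW q0) //.
rewrite -poweRM ?esup_ge0 // le_poweR ?(ltW q0)//.
  by apply: esup_ge0 => // i i1; rewrite mule_ge0 ?s0.
apply: le_esup => i mi; rewrite muleCA lee_wpmul2l //; exact: esup_ge.
Qed.

(** [poweRD_le] is used with exponent q inside the series and 1/q outside; the inner factor 2^q
    leaves the outer power as 2. *)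
Lemma sup_normD_le s t : (forall i, (1 <= i)%N -> 0 <= s i) ->
  (forall i, (1 <= i)%N -> 0 <= t i) ->
  sup_norm q a u (fun i => s i + t i)
  <= (sup_norm q a u s + sup_norm q a u t) * (2 * 2 `^ q^-1)%:E.
Proof.
move=> s0 t0; have qi0 : (0 < q^-1)%R by rewrite invr_gt0.
pose S := \sum_(1 <= m <oo) epow (esup s m) q * (a m)%:E.
pose T := \sum_(1 <= m <oo) epow (esup t m) q * (a m)%:E.
have S0 : 0 <= S by apply: nneseries_ge0 => m m1 _; exact: term_ge0.
have T0 : 0 <= T by apply: nneseries_ge0 => m m1 _; exact: term_ge0.
have H : \sum_(1 <= m <oo) epow (esup (fun i => s i + t i) m) q * (a m)%:E
         <= (S + T) * (2 `^ q)%:E.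
  rewrite /S /T -nneseriesD => [|m m1 _|m m1 _]; try exact: term_ge0.
  rewrite muleC; apply: (le_trans _ (nneseries_from1Zl_le _ _)); last 2 first.
  - by rewrite lee_fin powR_ge0.
  - by move=> m m1; rewrite adde_ge0 ?term_ge0.
  apply: le_nneseries_from1 => m m1; rewrite term_ge0 //=.
  rewrite -ge0_muleDl ?epow_ge0 // muleA lee_wpmul2r ?lee_fin ?a0 //.
  rewrite !epow_ge0E ?(ltW q0) // muleC.
  apply: le_trans (poweRD_le q0 (esup_ge0 m1 s0) (esup_ge0 m1 t0)).
  rewrite le_poweR ?(ltW q0) ?esup_ge0 //.
    by move=> i i1; rewrite adde_ge0 ?s0 ?t0.
  apply: le_esup => i mi; have i1 := leq_trans m1 mi.
  by rewrite ge0_muleDr ?s0 ?t0 // leeD // esup_ge.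
rewrite !sup_normE -/S -/T.
apply: (@le_trans _ _ (((S + T) * (2 `^ q)%:E) `^ q^-1)).
  rewrite le_poweR ?(ltW qi0) //.
  by apply: nneseries_ge0 => m m1 _; exact: term_ge0.
rewrite poweRM ?adde_ge0 ?lee_fin ?powR_ge0 // -poweR_EFin poweRK ?gt_eqF //.
rewrite EFinM muleA muleAC lee_wpmul2r ?lee_fin // poweRD_le //.
Qed.

End SupNorm.

(** * The right-hand sides: passing between series in [0, +oo] and bounds on real partial sums *)

Section Weights.
Variables (R : realType) (p : R) (b : nat -> R).
Hypotheses (p1 : (1 < p)%R) (b0 : nonneg_seq b) (b1 : (0 < b 1%N)%R).
Implicit Types x y : nat -> R.

Let p0 : (0 < p)%R. Proof. exact: lt_trans ltr01 p1. Qed.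

Let pm1 : (0 <= p - 1)%R. Proof. by rewrite subr_ge0 ltW. Qed.

Lemma BsumE n : Bsum b n = (psum b n)%:E.
Proof. by rewrite /Bsum sumEFin. Qed.

Lemma Binf_ge n : (psum b n)%:E <= Binf b.
Proof.
by rewrite -BsumE; apply: nneseries_from1_ge => m m1; rewrite lee_fin b0.
Qed.

Lemma Binf_gt0 : 0 < Binf b.
Proof. by apply: lt_le_trans (Binf_ge 1); rewrite lte_fin psum_gt0. Qed.

Lemma rhs_xE x : rhs_x p b x = (\sum_(1 <= m <oo) (b m * x m `^ p)%:E) `^ p^-1.
Proof.
rewrite /rhs_x epow_ge0E ?invr_ge0 ?(ltW p0) //; congr (_ `^ _).
by apply: eq_eseriesr => m _; rewrite epow_ge0E ?(ltW p0) // EFinM muleC.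
Qed.

Lemma rhs_x_le x (w : R) :
  (forall n, psum (fun k => b k * x k `^ p)%R n <= w)%R ->
  rhs_x p b x <= (w `^ p^-1)%:E.
Proof.
move=> H; have b0' m : (1 <= m)%N -> 0 <= (b m * x m `^ p)%:E.
  by move=> m1; rewrite lee_fin mulr_ge0 ?powR_ge0 ?b0.
rewrite rhs_xE -poweR_EFin le_poweR ?invr_ge0 ?(ltW p0) //.
  by apply: nneseries_ge0 => m m1 _; exact: b0'.
by apply: nneseries_from1_le => // n; rewrite sumEFin lee_fin; exact: H.
Qed.

Lemma rhs_x_fin x : rhs_x p b x < +oo -> exists2 w : R,
  rhs_x p b x = (w `^ p^-1)%:E &
  forall n, (psum (fun k => b k * x k `^ p) n <= w)%R.
Proof.
have b0' m : (1 <= m)%N -> 0 <= (b m * x m `^ p)%:E.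
  by move=> m1; rewrite lee_fin mulr_ge0 ?powR_ge0 ?b0.
rewrite rhs_xE => /(lty_poweRy (lt0r_neq0 _)).
rewrite invr_gt0 => /(_ p0).
set W := \sum_(1 <= m <oo) _ => Wy.
have W0 : 0 <= W by apply: nneseries_ge0 => m m1 _; exact: b0'.
have WE : W = (fine W)%:E by rewrite fineK // ge0_fin_numE.
exists (fine W); first by rewrite {1}WE.
by move=> n; rewrite -lee_fin -WE /psum -sumEFin; exact: nneseries_from1_ge.
Qed.

Definition rhs_y_term y m : \bar R :=
  epow (y m)%:E p * epow (Bsum b m.+1) (p - 1)%R * Bsum b m
          * epow (b m.+1)%:E (1 - p)%R.

Lemma rhs_yE y : rhs_y p b y = (\sum_(1 <= m <oo) rhs_y_term y m) `^ p^-1.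
Proof. by rewrite /rhs_y epow_ge0E // invr_ge0 ltW. Qed.

Lemma rhs_y_term_ge0 y m : 0 <= rhs_y_term y m.
Proof. by rewrite !mule_ge0 ?epow_ge0 // BsumE lee_fin psum_ge0. Qed.

(* If b(m+1) = 0, the left-hand side is 0 * oo = 0. *)
Lemma rhs_y_termE y m : (b m.+1 = 0 -> y m = 0)%R ->
  rhs_y_term y m
  = (y m `^ p * (psum b m * relinc b m `^ (1 - p)))%:E.
Proof.
move=> by0; rewrite /rhs_y_term !BsumE.
rewrite (epow_ge0E _ (ltW p0)) (epow_ge0E _ pm1).
have [bm|bm] := eqVneq (b m.+1) 0%R.
  by rewrite by0 // poweR0r ?gt_eqF // !mul0e powR0 ?gt_eqF // mul0r.
have bm0 : (0 < b m.+1)%R by rewrite lt_def bm b0.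
have P0 := psum_gt0 m b0 b1.
rewrite /epow subr_lt0 p1 opprB !poweR_EFin inver gt_eqF ?powR_gt0 //.
rewrite -!EFinM; congr EFin.
rewrite /relinc powRM ?invr_ge0 ?(ltW bm0) ?(ltW P0) //.
rewrite -powRN opprB -(powR_inv1 (ltW P0)) -powRrM.
by rewrite (_ : -1 * (1 - p) = p - 1)%R; ring.
Qed.

Lemma rhs_y_term_fin y m : nonneg_seq y -> (1 <= m)%N ->
  rhs_y_term y m < +oo -> b m.+1 = 0%R -> y m = 0%R.
Proof.
move=> y0 m1 /[swap] bm; rewrite /rhs_y_term bm !BsumE.
have [->//|ym] := eqVneq (y m) 0%R.
have {}ym : (0 < y m)%R by rewrite lt_def ym y0.
rewrite (epow_ge0E _ (ltW p0)) (epow_ge0E _ pm1).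
rewrite /epow subr_lt0 p1 opprB poweR0r ?gt_eqF ?subr_gt0 // inve0.
(* Since m >= 1, B(m) > 0, so the infinite factor b(m+1)^(1-p) is not cancelled by a zero. *)
case: m m1 ym bm => // m _ ym bm.
rewrite gt0_muley // !poweR_EFin -!EFinM lte_fin.
by rewrite !mulr_gt0 ?powR_gt0 ?psum_gt0.
Qed.

Lemma rhs_y_fin y : nonneg_seq y -> rhs_y p b y < +oo -> exists w : R,
  [/\ rhs_y p b y = (w `^ p^-1)%:E,
      (forall m, (1 <= m)%N -> b m.+1 = 0%R -> y m = 0%R) &
      forall n, (psum (fun m =>
        y m `^ p * (psum b m * relinc b m `^ (1 - p))) n <= w)%R].
Proof.
move=> y0; rewrite rhs_yE => /(lty_poweRy (lt0r_neq0 _)).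
rewrite invr_gt0 => /(_ p0).
set W := \sum_(1 <= m <oo) _ => Wy.
have W0 : 0 <= W by apply: nneseries_ge0 => m m1 _; exact: rhs_y_term_ge0.
have WE : W = (fine W)%:E by rewrite fineK // ge0_fin_numE.
have yb m : (1 <= m)%N -> b m.+1 = 0%R -> y m = 0%R.
  move=> m1; apply: rhs_y_term_fin => //; apply: le_lt_trans Wy.
  apply: le_trans (nneseries_from1_ge m _); last first.
    by move=> k _; exact: rhs_y_term_ge0.
  case: m m1 => // m _; rewrite big_nat_recr //= leeDr //.
  by apply: sume_from1_ge0 => k _; exact: rhs_y_term_ge0.
exists (fine W); split => //; first by rewrite {1}WE.
move=> n; rewrite -lee_fin -WE /psum -sumEFin.
apply: le_trans (nneseries_from1_ge n _); last first.
  by move=> k _; exact: rhs_y_term_ge0.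
by apply: lee_sum_from1 => m m1; rewrite rhs_y_termE //; exact: yb.
Qed.

Lemma rhs_y_le y (w : R) :
  (forall m, (1 <= m)%N -> b m.+1 = 0%R -> y m = 0%R) ->
  (forall n, psum (fun m =>
     y m `^ p * (psum b m * relinc b m `^ (1 - p))) n <= w)%R ->
  rhs_y p b y <= (w `^ p^-1)%:E.
Proof.
move=> yb H; rewrite rhs_yE -poweR_EFin le_poweR ?invr_ge0 ?(ltW p0) //.
  by apply: nneseries_ge0 => m m1 _; exact: rhs_y_term_ge0.
apply: nneseries_from1_le => [m _|n]; first exact: rhs_y_term_ge0.
apply: (@le_trans _ _ (psum (fun m =>
     y m `^ p * (psum b m * relinc b m `^ (1 - p))) n)%:E).
  rewrite /psum -sumEFin; apply: lee_sum_from1 => m m1.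
  by rewrite rhs_y_termE //; exact: yb.
by rewrite lee_fin.
Qed.

End Weights.

(** * From ( * ) to the bound on C_0 and to ( ** ) *)

Section Reduction.
Variables (R : realType) (p q : R).
Hypotheses (p1 : (1 < p)%R) (q0 : (0 < q)%R).

Let p0 : (0 < p)%R. Proof. exact: lt_trans ltr01 p1. Qed.

Let pV0 : (0 < p^-1)%R. Proof. by rewrite invr_gt0. Qed.

Section FixedData.
Variables a b u : nat -> R.
Hypotheses (a0 : nonneg_seq a) (b0 : nonneg_seq b) (u0 : nonneg_seq u).
Hypothesis b1 : (0 < b 1%N)%R.
Implicit Types x y : nat -> R.

Lemma C0_ge0 : 0 <= C0 p q a b u.
Proof. by rewrite mule_ge0 ?epow_ge0 // sup_norm_ge0. Qed.

Lemma rhs_x_ge0 x : 0 <= rhs_x p b x.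
Proof. exact: epow_ge0. Qed.

Lemma rhs_y_ge0 y : 0 <= rhs_y p b y.
Proof. exact: epow_ge0. Qed.

Lemma le_holds_x (C C' : R) : (C <= C')%R ->
  holds_x p q a b u C -> holds_x p q a b u C'.
Proof.
move=> CC H x x0 xd; apply: le_trans (H x x0 xd) _.
by rewrite lee_wpmul2r ?rhs_x_ge0 ?lee_fin.
Qed.

Lemma le_holds_y (D D' : R) : (D <= D')%R ->
  holds_y p q a b u D -> holds_y p q a b u D'.
Proof.
move=> DD H y y0; apply: le_trans (H y y0) _.
by rewrite lee_wpmul2r ?rhs_y_ge0 ?lee_fin.
Qed.

Lemma C0_le (C : R) : (0 <= C)%R -> holds_x p q a b u C -> C0 p q a b u <= C%:E.
Proof.
move=> C0' /(_ (fun=> 1%R)) H.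
have : lhs_x q a u (fun=> 1%R) <= C%:E * rhs_x p b (fun=> 1%R).
  by apply: H => [m _|m n _ _]; rewrite ?ler01.
rewrite /lhs_x (_ : (fun i => _) = (fun i => (i%:R)%:E)); last first.
  by apply/funext => i; exact: sum_one_from1.
rewrite rhs_xE //; under eq_eseriesr do rewrite powR1 mulr1.
rewrite -/(Binf b) /C0 /epow oppr_lt0 pV0 opprK.
have : 0 < Binf b `^ p^-1 by rewrite poweR_gt0 // Binf_gt0.
(* If B(oo)^(1/p) = +oo, the second factor of [C0] is 0 and the bound is trivial. *)
case: (Binf b `^ p^-1) => [r| |] //; last by rewrite invey mule0 lee_fin.
rewrite lte_fin => r0 N; rewrite inver gt_eqF // lee_pdivrMr //.
Qed.

(** Copson's inequality is assumed for finite sums only, so it is applied to the truncated tails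
    [X N]. The resulting bound, uniform in N, shows that the full tails are finite and passes to
    them, which makes them admissible in ( * ). *)
Lemma holds_y_of_holds_x (K C : R) : (0 < C)%R -> (0 < K)%R ->
  (forall X n, nonneg_seq X ->
    (forall k, (1 <= k)%N -> X k.+1 <= X k)%R -> X n.+1 = 0%R ->
    (forall k, (1 <= k)%N -> b k.+1 = 0%R -> X k = X k.+1) ->
    psum (fun k => b k * X k `^ p)%R n
      <= K * psum (fun k => (X k - X k.+1) `^ p
                            * (psum b k * relinc b k `^ (1 - p))) n)%R ->
  holds_x p q a b u C -> holds_y p q a b u (C * K `^ p^-1)%R.
Proof.
move=> C0' K0 copsonK Hx y y0.
have K'0 : (0 < C * K `^ p^-1)%R by rewrite mulr_gt0 ?powR_gt0.
(* Positivity of the constant matters here, because 0 * +oo = 0. *)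
have [->|] := eqVneq (rhs_y p b y) +oo.
  by rewrite gt0_muley ?lte_fin ?leey.
rewrite -ltey => /(rhs_y_fin p1 b0 b1 y0) [w [wE yb yw]].
pose X N k : R := (\sum_(k <= j < N.+1) y j)%R.
have X0 N : nonneg_seq (X N).
  move=> k k1; rewrite /X big_nat sumr_ge0 // => j /andP[kj _].
  by rewrite y0 // (leq_trans k1).
have XB N k : (k <= N)%N -> (X N k - X N k.+1 = y k)%R.
  by move=> kN; rewrite /X [X in (X - _)%R]big_ltn ?ltnS // addrK.
have Xout N k : (N < k)%N -> X N k = 0%R by move=> Nk; rewrite /X big_geq.
have cop N : (psum (fun k => b k * X N k `^ p) N <= K * w)%R.
  apply: le_trans (copsonK (X N) N (X0 N) _ _ _) _ => [k k1||k k1 bk|].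
  - have [kN|Nk] := leqP k N; first by rewrite -subr_ge0 XB ?y0.
    by rewrite !Xout // ltnW.
  - exact: Xout.
  - have [kN|Nk] := leqP k N; last by rewrite !Xout // ltnW.
    by apply/eqP; rewrite -subr_eq0 XB // yb.
  - rewrite ler_pM2l // (le_trans _ (yw N)) // /psum.
    rewrite big_nat [leRHS]big_nat ler_sum // => k /andP[k1 kN].
    by rewrite XB.
have Kw0 : (0 <= K * w)%R by have := cop 0%N; rewrite psum0.
pose tail k : \bar R := \sum_(k <= j <oo) (y j)%:E.
have yE j k : (1 <= k)%N -> (k <= j)%N -> 0 <= (y j)%:E.
  by move=> k1 kj; rewrite lee_fin y0 // (leq_trans k1).
have tail0 k : (1 <= k)%N -> 0 <= tail k.
  by move=> k1; apply: nneseries_ge0 => j kj _; exact: (yE j k).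
(* The first term b(1) X(N,1)^p of the Copson sum is at most K w, and b(1) > 0. *)
have tail1 : tail 1%N < +oo.
  apply: (@le_lt_trans _ _ ((K * w / b 1%N) `^ p^-1)%:E); last exact: ltry.
  apply: nneseries_from1_le => [j j1|N]; first exact: (yE j 1%N).
  rewrite sumEFin lee_fin -/(X N 1%N).
  case: N => [|N]; first by rewrite Xout ?powR_ge0.
  have X10 := X0 N.+1 1%N isT.
  rewrite -[leLHS](powRr1 X10) -(mulfV (lt0r_neq0 p0)) powRrM.
  rewrite ge0_ler_powR ?nnegrE ?powR_ge0 ?(ltW pV0) //.
    by rewrite divr_ge0 // ltW.
  rewrite ler_pdivlMr // mulrC (le_trans _ (cop N.+1)) //.
  rewrite psum_shift lerDl psum_ge0 // => m m1.
  by rewrite mulr_ge0 ?powR_ge0 ?b0.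
have tailB k N : (1 <= k)%N -> (k <= N.+1)%N ->
    tail k = (X N k)%:E + tail N.+1.
  move=> k1 kN; rewrite /tail (@nneseries_split _ _ k (N.+1 - k)) => [|j kj].
    by rewrite subnKC // sumEFin.
  exact: (yE j k).
pose x k := fine (tail k).
have tailE k : (1 <= k)%N -> tail k = (x k)%:E.
  move=> k1; rewrite /x fineK // ge0_fin_numE ?tail0 //.
  apply: le_lt_trans tail1; case: k k1 => // k _.
  by rewrite (tailB 1%N k) // leeDr // lee_fin X0.
have x0 : nonneg_seq x by move=> k k1; rewrite -lee_fin -tailE ?tail0.
have xB k N : (1 <= k)%N -> (k <= N.+1)%N -> x k = (X N k + x N.+1)%R.
  move=> k1 kN; apply: EFin_inj.
  by rewrite EFinD -!tailE // -tailB.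
have xd : nonincreasing_from1 x.
  move=> m n m1; case: n => [|n mn].
    by rewrite leqn0 => /eqP m0; rewrite m0 in m1.
  by rewrite (xB m n) // lerDr X0.
(* The truncated tails X N k = x k - x N.+1 satisfy the bound by [cop]; passing
   to x costs at most Q * x N.+1 = Q * (x 1 - X N 1), and x 1 = sup X N 1. *)
have xw n : (psum (fun k => b k * x k `^ p) n <= K * w)%R.
  pose Q := (p * x 1%N `^ (p - 1) * psum b n)%R.
  have Q0 : (0 <= Q)%R by rewrite !mulr_ge0 ?powR_ge0 ?psum_ge0 // ltW.
  have le1 N : (n <= N)%N ->
      (psum (fun k => b k * x k `^ p) n <= K * w + Q * x N.+1)%R.
    move=> nN; apply: (@le_trans _ _ (psum (fun k =>
        b k * X N k `^ p + p * x 1%N `^ (p - 1) * x N.+1 * b k) n)%R).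
      rewrite /psum big_nat [leRHS]big_nat ler_sum // => k /andP[k1 kn].
      have kN : (k <= N.+1)%N by rewrite (leq_trans (ltnW kn)) ?ltnS.
      rewrite [X in (_ <= _ + X)%R]mulrC -mulrDr ler_wpM2l ?b0 //.
      have := powR_sub_le_tangent p1 (x0 _ k1) (X0 N _ k1).
      rewrite lerBlDl => /le_trans; apply; rewrite lerD2l.
      rewrite {2}(xB k N) // [(X N k + _)%R]addrC addrK ler_wpM2r ?x0 //.
      rewrite ler_pM2l // ge0_ler_powR ?nnegrE ?x0 ?subr_ge0 ?(ltW p1) //.
      exact: xd.
    rewrite psumD psumZ /Q [X in (_ <= _ + X)%R]mulrAC lerD2r.
    apply: le_trans (cop N); apply: psum_nondecreasing => // m m1.
    by rewrite mulr_ge0 ?powR_ge0 ?b0 //; exact: X0.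
  have [Q00|Qn0] := eqVneq Q 0%R.
    by have := le1 n (leqnn n); rewrite Q00 mul0r addr0.
  have {Qn0}Qp : (0 < Q)%R by rewrite lt_def Qn0.
  set S := psum _ n in le1 *.
  (* For Q > 0, [le1] is an upper bound on X(N,1) for N >= n; its supremum over N is x(1), and the
     terms Q x(1) cancel. *)
  have : tail 1%N <= ((K * w + Q * x 1%N - S) / Q)%:E.
    apply: nneseries_from1_le => [j j1|N]; first exact: (yE j 1%N).
    rewrite sumEFin lee_fin -/(X N 1%N).
    apply: (@le_trans _ _ (X (maxn n N) 1%N)).
      rewrite /X [leRHS](big_cat_nat _ (n := N.+1)) //= ?ltnS ?leq_maxr //.
      rewrite lerDl big_nat sumr_ge0 // => j /andP[Nj _].
      by rewrite y0 // (leq_ltn_trans _ Nj).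
    rewrite ler_pdivlMr //; have := le1 _ (leq_maxl n N).
    rewrite (xB 1%N (maxn n N)) //; lra.
  by rewrite tailE // lee_fin ler_pdivlMr //; lra.
have -> : lhs_y q a u y = lhs_x q a u x.
  rewrite /lhs_y /lhs_x; congr sup_norm; apply/funext => i.
  by apply: eq_big_nat => k /andP[k1 _]; rewrite -tailE.
apply: le_trans (Hx x x0 xd) _.
rewrite EFinM -muleA lee_pmul2l ?lte_fin // wE -EFinM -powRM ?(ltW K0) //.
  exact: rhs_x_le.
by have := yw 0%N; rewrite psum0.
Qed.

End FixedData.
End Reduction.

(** * From ( ** ) and C_0 to ( * ) *)

Section Converse.
Variables (R : realType) (p q : R).
Hypotheses (p1 : (1 < p)%R) (q0 : (0 < q)%R).
Variables a b u : nat -> R.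
Hypotheses (a0 : nonneg_seq a) (b0 : nonneg_seq b) (u0 : nonneg_seq u).
Hypothesis b1 : (0 < b 1%N)%R.
Implicit Types x y : nat -> R.

Let p0 : (0 < p)%R. Proof. exact: lt_trans ltr01 p1. Qed.

Let pV0 : (0 < p^-1)%R. Proof. by rewrite invr_gt0. Qed.

Lemma le_wmean x n : nonneg_seq x -> nonincreasing_from1 x -> (1 <= n)%N ->
  (x n <= wmean b x n)%R.
Proof.
move=> x0 xd; case: n => // n _; rewrite ler_pdivlMr ?psum_gt0 // mulrC.
rewrite /psum mulr_suml big_nat [leRHS]big_nat ler_sum // => k /andP[k1 kn].
by rewrite ler_wpM2l ?b0 ?xd.
Qed.

Lemma wmean_telescope x k n : nonneg_seq x -> (1 <= k)%N -> (k <= n)%N ->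
  (wmean b x k
   <= wmean b x n + \sum_(k <= j < n) relinc b j * wmean b x j)%R.
Proof.
move=> x0 k1; elim: n => [|n IH].
  by rewrite leqn0 => /eqP k0; rewrite k0 in k1.
rewrite leq_eqVlt => /predU1P[->|]; first by rewrite big_geq // addr0.
rewrite ltnS => kn; apply: le_trans (IH kn) _.
rewrite big_nat_recr //= [leLHS]addrC addrCA lerD2l.
(* Multiplied by B(n+1), the step reduces to b(n+1) x(n+1) >= 0. *)
rewrite -(ler_pM2l (psum_gt0 n b0 b1)) mulrDr (mulrA _ (relinc b n)).
rewrite psum_wmeanS // psum_relincE // -(psum_onem_relinc b0 b1 n).
have := psum_relincE b0 b1 n; have := b0 (ltn0Sn n); have := x0 n.+1 (ltn0Sn n).
move=> xn bn E; have bx := mulr_ge0 bn xn.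
rewrite mulrBr mulr1 E; lra.
Qed.

(** Let t be the tail sum of y from k. If z = x(k) - t > 0, then z <= sigma(n) for all n >= k, so
    B(n) z^p <= M for all n and B(oo) z^p <= M. In particular z > 0 forces B(oo) to be finite. *)
Lemma le_Binf_tail x y (M : R) k : (0 <= M)%R -> (1 <= k)%N ->
  nonneg_seq y ->
  (forall n, psum b n * wmean b x n `^ p <= M)%R ->
  (forall n, (k <= n)%N ->
     (x k <= wmean b x n + \sum_(k <= j < n) y j)%R) ->
  (x k)%:E <= (M `^ p^-1)%:E * epow (Binf b) (- p^-1)%R
              + \sum_(k <= j <oo) (y j)%:E.
Proof.
move=> M0 k1 y0 Bw xk.
have yE j : (k <= j)%N -> 0 <= (y j)%:E.
  by move=> kj; rewrite lee_fin y0 // (leq_trans k1).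
have L0 : 0 <= (M `^ p^-1)%:E * epow (Binf b) (- p^-1)%R.
  by rewrite mule_ge0 ?epow_ge0 ?lee_fin ?powR_ge0.
have T0 : 0 <= \sum_(k <= j <oo) (y j)%:E.
  by apply: nneseries_ge0 => j kj _; exact: yE.
have [->|] := eqVneq (\sum_(k <= j <oo) (y j)%:E) +oo.
  by rewrite addey ?leey // gt_eqF // (lt_le_trans _ L0) ?ltNyr.
rewrite -ltey => Ty.
have TE : \sum_(k <= j <oo) (y j)%:E = (fine (\sum_(k <= j <oo) (y j)%:E))%:E.
  by rewrite fineK // ge0_fin_numE.
have ySle n : (\sum_(k <= j < n) y j <= fine (\sum_(k <= j <oo) (y j)%:E))%R.
  rewrite -lee_fin -TE -sumEFin; apply: nneseries_lim_ge => j kj _; exact: yE.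
rewrite TE; set t := fine _ in ySle *.
have [xt|tx] := leP (x k) t; first by rewrite -[leLHS]add0e leeD ?lee_fin.
have z0 : (0 < x k - t)%R by rewrite subr_gt0.
have zp0 : (0 < (x k - t) `^ p)%R by exact: powR_gt0.
have zw n : (k <= n)%N -> (x k - t <= wmean b x n)%R.
  by move=> kn; have := xk n kn; have := ySle n; lra.
have Bz n : (psum b n <= M / (x k - t) `^ p)%R.
  rewrite (le_trans (psum_nondecreasing b0 (leq_maxr k n))) //.
  rewrite ler_pdivlMr // (le_trans _ (Bw (maxn k n))) //.
  rewrite ler_wpM2l ?psum_ge0 // ge0_ler_powR ?nnegrE ?(ltW p0) ?(ltW z0) //.
    by rewrite (le_trans (ltW z0)) // zw // leq_maxl.
  by rewrite zw // leq_maxl.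
have Binfz : Binf b <= (M / (x k - t) `^ p)%:E.
  apply: nneseries_from1_le => [m m1|n]; first by rewrite lee_fin b0.
  by rewrite sumEFin lee_fin; exact: Bz.
have := Binf_gt0 b0 b1; move: Binfz L0.
case: (Binf b) => [B| |] //; rewrite !lee_fin lte_fin => BM _ B0.
rewrite /epow oppr_lt0 pV0 opprK poweR_EFin inver gt_eqF ?powR_gt0 //.
rewrite -EFinM -EFinD lee_fin -lerBlDr ler_pdivlMr ?powR_gt0 //.
rewrite -[X in (X * _)%R](powRr1 (ltW z0)) -(mulfV (lt0r_neq0 p0)) powRrM.
rewrite -powRM ?powR_ge0 ?(ltW B0) // ge0_ler_powR ?nnegrE ?(ltW pV0) //.
  by rewrite mulr_ge0 ?powR_ge0 ?(ltW B0).
by rewrite mulrC -ler_pdivlMr.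
Qed.

(** The factor 2 * 2^(1/q) is the price of splitting x into a constant and a tail sum; K^(1/p) comes
    from Hardy's inequality, used for both parts. *)
Lemma holds_x_of_holds_y (K D c0 : R) : (0 < K)%R -> (0 < D)%R -> (0 <= c0)%R ->
  (forall x n, nonneg_seq x ->
    psum (fun k => psum b k * wmean b x k `^ p * relinc b k) n
      <= K * psum (fun k => b k * x k `^ p) n.+1 /\
    psum b n * wmean b x n `^ p <= K * psum (fun k => b k * x k `^ p) n)%R ->
  C0 p q a b u <= c0%:E -> holds_y p q a b u D ->
  holds_x p q a b u (2 * 2 `^ q^-1 * K `^ p^-1 * (D + c0))%R.
Proof.
move=> K0 D0 c00 hardyK C0c Hy x x0 xd.
have tq0 : (0 < 2 * 2 `^ q^-1 :> R)%R by rewrite mulr_gt0 ?powR_gt0.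
have Kp0 : (0 < K `^ p^-1)%R by exact: powR_gt0.
have Dc0 : (0 < D + c0)%R by rewrite ltr_wpDr.
have K'0 : (0 < 2 * 2 `^ q^-1 * K `^ p^-1 * (D + c0))%R by rewrite !mulr_gt0.
have [->|] := eqVneq (rhs_x p b x) +oo.
  by rewrite gt0_muley ?lte_fin ?leey.
rewrite -ltey => /(rhs_x_fin p1 b0) [w wE xw].
have w0 : (0 <= w)%R by have := xw 0%N; rewrite psum0.
have Kw0 : (0 <= K * w)%R by rewrite mulr_ge0 // ltW.
pose y j := (relinc b j * wmean b x j)%R.
have y0 : nonneg_seq y.
  by move=> j _; rewrite mulr_ge0 ?wmean_ge0 ?relinc_ge0.
have yb m : (1 <= m)%N -> b m.+1 = 0%R -> y m = 0%R.
  by move=> _ bm; rewrite /y /relinc bm !mul0r.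
have rhsy : rhs_y p b y <= ((K * w) `^ p^-1)%:E.
  apply: rhs_y_le => // n.
  apply: (@le_trans _ _ (K * psum (fun k => b k * x k `^ p) n.+1)%R);
    last first.
    by rewrite ler_pM2l.
  apply: le_trans (hardyK x n x0).1; apply: le_psum => k k1.
  rewrite /y powRM ?relinc_ge0 ?wmean_ge0 //.
  have [->|rn] := eqVneq (relinc b k) 0%R.
    by rewrite powR0 ?gt_eqF // !mul0r mulr0.
  (* This identity turns y^p B theta^(1-p) into B sigma^p theta, the summand of Hardy's
     inequality. *)
  have rE : relinc b k = (relinc b k `^ p * relinc b k `^ (1 - p))%R.
    by rewrite -powRD ?rn ?implybT // subrKC powRr1 ?relinc_ge0.
  by rewrite [X in (_ <= _ * X)%R]rE le_eqVlt; apply/orP; left; apply/eqP; ring.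
pose L := ((K * w) `^ p^-1)%:E * epow (Binf b) (- p^-1)%R.
have L0 : 0 <= L by rewrite mule_ge0 ?epow_ge0 ?lee_fin ?powR_ge0.
pose tail k : \bar R := \sum_(k <= j <oo) (y j)%:E.
have tail0 k : (1 <= k)%N -> 0 <= tail k.
  move=> k1; apply: nneseries_ge0 => j kj _.
  by rewrite lee_fin y0 // (leq_trans k1).
have xle k : (1 <= k)%N -> (x k)%:E <= L + tail k.
  move=> k1; apply: le_Binf_tail => // [n|n kn].
    by apply: le_trans (hardyK x n x0).2 _; rewrite ler_pM2l.
  by apply: le_trans (le_wmean x0 xd k1) _; exact: wmean_telescope.
have tsum0 i : 0 <= \sum_(1 <= k < i.+1) tail k by exact: sume_from1_ge0.
have iE0 i : 0 <= (i%:R : R)%:E by rewrite lee_fin.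
have lhs1 : lhs_x q a u x <= sup_norm q a u (fun i =>
    L * (i%:R)%:E + \sum_(1 <= k < i.+1) tail k).
  apply: le_sup_norm => // i i1; apply/andP; split.
    by apply: sume_from1_ge0 => k k1; rewrite lee_fin x0.
  apply: (le_trans (lee_sum_from1 i xle)); rewrite big_split /= leeD2r //.
  rewrite (_ : L * _ = \sum_(1 <= k < i.+1) L) //.
  rewrite -sum_one_from1 ge0_sume_distrr => [|k _]; last by rewrite lee_fin.
  by apply: eq_bigr => k _; rewrite mule1.
apply: (le_trans lhs1).
apply: le_trans (sup_normD_le q0 a0 u0 _ _) _ => [i _|i _|].
- by rewrite mule_ge0.
- exact: tsum0.
rewrite -/(lhs_y q a u y) [leLHS]muleC.
rewrite -(mulrA (2 * _)%R) [in leRHS]EFinM -[leRHS]muleA lee_pmul2l ?lte_fin //.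
rewrite wE -EFinM mulrAC -(powRM _ (ltW K0) w0) mulrDr EFinD.
rewrite [leLHS]addeC leeD //.
  by apply: le_trans (Hy y y0) _; rewrite mulrC EFinM lee_pmul2l ?lte_fin.
(* Summed over k <= i, the constant [L] gives L i; its factor B(oo)^(-1/p) completes the norm of i
   to [C0]. *)
apply: le_trans (sup_normZ_le q0 a0 u0 L0 _) _ => //.
rewrite /L -muleA EFinM lee_wpmul2l ?lee_fin ?powR_ge0 //.
by rewrite muleC.
Qed.

End Converse.

(** * The equivalence and the comparison of best constants *)

Theorem theorem3p1 (R : realType) (p q : R) (hq : (0 < q)%R) (hp : (1 < p)%R) :
  exists2 c : R, (0 < c)%R &
    forall a b u : nat -> R,
      nonneg_seq a -> nonneg_seq b -> nonneg_seq u -> (0 < b 1%N)%R ->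
      ((exists2 C : R, (0 <= C)%R & holds_x p q a b u C) <->
         (C0 p q a b u < +oo /\
          exists2 D : R, (0 <= D)%R & holds_y p q a b u D)) /\
      ((c^-1)%:E * (best_y p q a b u + C0 p q a b u) <= best_x p q a b u /\
       best_x p q a b u <= c%:E * (best_y p q a b u + C0 p q a b u)).
Proof.
have [Kh Kh0 HK] := hardy_ineq hp; have [Kc Kc0 CK] := copson_ineq hp.
pose K1 := (Kc `^ p^-1)%R; pose K2 := (2 * 2 `^ q^-1 * Kh `^ p^-1)%R.
have K10 : (0 < K1)%R by exact: powR_gt0.
have K20 : (0 < K2)%R by rewrite !mulr_gt0 ?powR_gt0.
have c0 : (0 < K1 + 1 + K2)%R by lra.
(* K1 + 1 serves the lower estimate, with K1 for [best_y] and 1 for [C0]; K2 serves the upper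
   one. *)
exists (K1 + 1 + K2)%R => // a b u a0 b0 u0 b1.
have fwd (C : R) : (0 < C)%R ->
    holds_x p q a b u C -> holds_y p q a b u (C * K1)%R.
  move=> C0; apply: holds_y_of_holds_x => // X n X0 Xd Xn Xb.
  exact: CK.
have bwd (D d : R) : (0 < D)%R -> (0 <= d)%R -> C0 p q a b u <= d%:E ->
    holds_y p q a b u D -> holds_x p q a b u (K2 * (D + d))%R.
  move=> D0 d0; apply: holds_x_of_holds_y => // x n x0.
  exact: HK.
have C0ge0 := C0_ge0 p q a b u.
have besty0 : 0 <= best_y p q a b u.
  by apply/ereal_infP => _ [D [D0 _] <-]; rewrite lee_fin.
split; [split=> [[C C0' HC]|[C0y [D D0 HD]]]|split].
- split; first by apply: le_lt_trans (C0_le hp b0 b1 C0' HC) _; exact: ltry.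
  (* C may be 0 while [fwd] asks for a positive constant, hence C + 1; below, D + 1 and C + e have
     the same purpose. *)
  exists ((C + 1) * K1)%R; first by rewrite mulr_ge0 ?(ltW K10) //; lra.
  by apply: fwd; [lra|apply: le_holds_x HC; lra].
- have C0E : C0 p q a b u = (fine (C0 p q a b u))%:E.
    by rewrite fineK // ge0_fin_numE.
  have f0 : (0 <= fine (C0 p q a b u))%R by exact: fine_ge0.
  exists (K2 * ((D + 1) + fine (C0 p q a b u)))%R.
    by rewrite mulr_ge0 ?(ltW K20) //; lra.
  apply: bwd => //; [lra|by rewrite -C0E|].
  by apply: le_holds_y HD; lra.
- apply/ereal_infP => _ [C [C0' HC] <-].
  apply/lee_addgt0Pr => e e0; rewrite -EFinD.
  have Ce0 : (0 < C + e)%R by lra.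
  have HCe : holds_x p q a b u (C + e)%R by apply: le_holds_x HC; lra.
  have yle : best_y p q a b u <= ((C + e) * K1)%:E.
    apply: ereal_inf_lbound; exists ((C + e) * K1)%R => //.
    by split; [rewrite mulr_ge0 // ltW|exact: fwd].
  have := leeD yle (C0_le hp b0 b1 (ltW Ce0) HCe).
  rewrite -EFinD => /le_trans H.
  rewrite lee_pdivrMl // -EFinM; apply: H; rewrite lee_fin.
  by have := mulr_gt0 K20 Ce0; lra.
- have [C0y|C0ny] := eqVneq (C0 p q a b u) +oo.
    rewrite C0y addey ?gt0_muley ?lte_fin ?leey // gt_eqF //.
    by rewrite (lt_le_trans _ besty0) ?ltNyr.
  have C0E : C0 p q a b u = (fine (C0 p q a b u))%:E.
    by rewrite fineK // ge0_fin_numE // ltey.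
  have f0 : (0 <= fine (C0 p q a b u))%R by exact: fine_ge0.
  set d := fine _ in C0E f0; rewrite C0E.
  apply: (@le_trans _ _ (K2%:E * (best_y p q a b u + d%:E))); last first.
    by rewrite lee_wpmul2r ?adde_ge0 ?lee_fin //; lra.
  (* Solving for [best_y] reduces the estimate to a lower bound to be checked at each admissible
     D. *)
  rewrite -lee_pdivrMl // -leeBlDr //.
  apply/ereal_infP => _ [D [D0 HD] <-].
  rewrite leeBlDr // lee_pdivrMl // -EFinD -EFinM.
  apply/lee_addgt0Pr => e e0; rewrite -EFinD.
  (* The increment e / K2 makes D positive and becomes exactly e after multiplication by K2. *)
  have De0 : (0 < D + e / K2)%R by rewrite ltr_wpDl // divr_gt0.
  apply: ereal_inf_lbound; exists (K2 * (D + e / K2 + d))%R.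
    split; first by rewrite mulr_ge0 ?(ltW K20) //; lra.
    apply: bwd => //; first by rewrite C0E.
    by apply: le_holds_y HD; rewrite lerDl divr_ge0 // ltW.
  by congr EFin; field; rewrite gt_eqF.
Qed.
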